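(* Let $(M,F=\alpha^2/\beta)$ be a Kropina space with navigation data $(h,W)$, and let $\{\varphi_t\}_{t\in I_\epsilon}$ be a local $1$-parameter group of local transformations on $M$ which generates the vector field $W$. Then the $\varphi_t$ $(\epsilon>t>0)$ are Finslerian local isometries of the Kropina metric $F=\alpha^2/\beta$ if and only if $(M,F)$ is a strong Kropina space. Namely, $\{\varphi_t\}$ is a local $1$-parameter group of Finslerian local isometries of the Kropina metric $F=\alpha^2/\beta$ if and only if $\{\varphi_t\}$ is a local $1$-parameter group of local isometries of the Riemannian space $(M,h)$.
   Context: Kropina space: $M$ is an $n$-dimensional differentiable manifold, $\alpha=\sqrt{a_{ij}(x)y^iy^j}$ is a Riemannian metric on $M$, $\beta=b_i(x)y^i$ is a nowhere vanishing 1-form, and $F=\alpha^2/\beta$ is regarded as a conic Finsler metric on the domain $\{(x,y)\in TM:\beta(x,y)>0\}$. Navigation data: with $b^2:=a^{ij}b_ib_j$ ($(a^{ij})$ the inverse matrix of $(a_{ij})$), let $\kappa=\kappa(x)$ be the function on $M$ defined by $e^{\kappa}b^2=4$, and put $h_{ij}:=e^{\kappa}a_{ij}$, $2W_i:=e^{\kappa}b_i$, $W^i:=h^{ij}W_j$, where $(h^{ij})$ is the inverse matrix of $(h_{ij})$. Then $h=\sqrt{h_{ij}y^iy^j}$ is a Riemannian metric and $W=W^i\,\partial/\partial x^i$ is a vector field of constant $h$-length $1$; $(h,W)$ is called the navigation data of $F$. Strong Kropina space: a Kropina space for which $W$ is a unit Killing vector field of $(M,h)$. Local 1-parameter group generating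 $W$: for each $p\in M$ there are a neighbourhood $U$ of $p$, a number $\epsilon>0$ and local transformations $\varphi_t:U\to M$, $t\in I_\epsilon=(-\epsilon,\epsilon)$, forming the local flow of $W$ (so $\varphi_0=\mathrm{id}$ and $\frac{d}{dt}\varphi_t(q)|_{t=0}=W(q)$). Statements about $\varphi_t$ $(\epsilon>t>0)$ are meant for all such $p,U,\epsilon$ and all $0<t<\epsilon$. A local transformation $\phi:U\to M$ ($U\subset M$ open) is a Finslerian local isometry if $F(\phi(x),d\phi_x(y))=F(x,y)$ for all $(x,y)\in TU$ in the domain of $F$ (with $(\phi(x),d\phi_x(y))$ again in the domain). *)

(* Defs.v *)
From HB Require Import structures.
From mathcomp Require Import all_boot all_order all_algebra.
From mathcomp Require Import all_classical all_reals all_analysis.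

Set Implicit Arguments.
Unset Strict Implicit.
Unset Printing Implicit Defensive.

Import Order.TTheory GRing.Theory Num.Theory.
Import numFieldNormedType.Exports.

Local Open Scope classical_set_scope.
Local Open Scope ring_scope.

(* In [Ck] and [smooth_on] the functions are total and the derivatives are taken
   in the whole space, so these notions are meant for an open set [A]; in finite
   dimension they are then the usual classes C^k and C^oo on [A]. *)
Fixpoint Ck (R : realType) (V W : normedModType R) (k : nat) (A : set V)
    (f : V -> W) : Prop :=
  if k is k'.+1 then
    (forall x, A x -> differentiable f x) /\
    (forall v, Ck k' A (fun x => 'D_v f x))
  else forall x, A x -> {for x, continuous f}.

Definition smooth_on (R : realType) (V W : normedModType R) (A : set V)
    (f : V -> W) : Prop := forall k, Ck k A f.

(* An n-dimensional C^oo manifold: a Hausdorff, second countable space with a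
   smooth atlas. The chart [i] is the homeomorphism [coord i] from the open set
   [dom i] onto an open subset of R^n, with inverse [point i]; the values of
   [coord i] and [point i] elsewhere are irrelevant. *)
Record smoothManifold (R : realType) (n : nat) := SmoothManifold {
  space :> topologicalType;
  space_hausdorff : hausdorff_space space;
  space_second_countable : @second_countable space;
  atlas : Type;
  dom : atlas -> set space;
  coord : atlas -> space -> 'rV[R]_n;
  point : atlas -> 'rV[R]_n -> space;
  dom_open : forall i, open (dom i);
  dom_cover : forall x, exists i, dom i x;
  coord_open : forall i, open (coord i @` dom i);
  coordK : forall i x, dom i x -> point i (coord i x) = x;
  coord_continuous : forall i x, dom i x -> {for x, continuous (coord i)};
  point_continuous : forall i u, (coord i @` dom i) u ->
    {for u, continuous (point i)};
  transition_smooth : forall i j,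
    smooth_on (coord i @` (dom i `&` dom j)) (fun u => coord j (point i u))
}.

Section Manifold.
Variables (R : realType) (n : nat) (M : smoothManifold R n).

Definition in_charts (f : M -> M) (i j : atlas M) (u : 'rV[R]_n) : 'rV[R]_n :=
  coord j (f (point i u)).

(* A tangent vector at [x] is given by its components [y] in a chart [i] around
   [x]; [tangent_map f i j x y] gives the components of df_x(y) in the chart [j]
   around [f x]. *)
Definition tangent_map (f : M -> M) (i j : atlas M) (x : M) (y : 'rV[R]_n) :
    'rV[R]_n := 'd (in_charts f i j) (coord i x) y.

Definition smooth_map (U : set M) (f : M -> M) : Prop :=
  (forall x, U x -> {for x, continuous f}) /\
  (forall i j, smooth_on (coord i @` (U `&` dom i `&` f @^-1` dom j))
                         (in_charts f i j)).

Definition local_transformation (U : set M) (f : M -> M) : Prop :=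
  [/\ open U, open (f @` U), smooth_map U f &
      exists2 f' : M -> M, smooth_map (f @` U) f' & forall x, U x -> f' (f x) = x].

(* Tensor fields are given by their components in each chart; only the values
   at points of the domain of the chart are relevant. *)
Definition cotensor2 := atlas M -> M -> 'M[R]_n.
Definition covector_field := atlas M -> M -> 'rV[R]_n.
Definition vector_field := atlas M -> M -> 'rV[R]_n.

Definition bilinear (g : 'M[R]_n) (y z : 'rV[R]_n) : R :=
  \sum_(k < n) \sum_(l < n) g k l * y 0 k * z 0 l.

Definition pairing (b y : 'rV[R]_n) : R := \sum_(k < n) b 0 k * y 0 k.

Record riemannian_metric (g : cotensor2) : Prop := RiemannianMetric {
  metric_sym : forall i x, dom i x -> (g i x)^T = g i x;
  metric_pos : forall i x, dom i x ->
    forall y, y != 0 -> 0 < bilinear (g i x) y y;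
  metric_smooth : forall i,
    smooth_on (coord i @` dom i) (fun u => g i (point i u));
  metric_change : forall i j x, dom i x -> dom j x -> forall y z,
    bilinear (g j x) (tangent_map id i j x y) (tangent_map id i j x z) =
    bilinear (g i x) y z
}.

Record one_form (b : covector_field) : Prop := OneForm {
  form_smooth : forall i,
    smooth_on (coord i @` dom i) (fun u => b i (point i u));
  form_change : forall i j x, dom i x -> dom j x -> forall y,
    pairing (b j x) (tangent_map id i j x y) = pairing (b i x) y
}.

Record kropina := Kropina {
  ka : cotensor2;
  kb : covector_field;
  ka_metric : riemannian_metric ka;
  kb_form : one_form kb;
  kb_nonzero : forall i x, dom i x -> kb i x != 0
}.

Definition alpha (K : kropina) (i : atlas M) (x : M) (y : 'rV[R]_n) : R :=
  Num.sqrt (bilinear (ka K i x) y y).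

Definition beta (K : kropina) (i : atlas M) (x : M) (y : 'rV[R]_n) : R :=
  pairing (kb K i x) y.

(* Only meaningful where [0 < beta K i x y]. *)
Definition kropina_metric (K : kropina) (i : atlas M) (x : M) (y : 'rV[R]_n) :
    R := alpha K i x y ^+ 2 / beta K i x y.

Definition form_norm2 (K : kropina) (i : atlas M) (x : M) : R :=
  bilinear (invmx (ka K i x)) (kb K i x) (kb K i x).

Definition is_kappa (K : kropina) (kappa : M -> R) : Prop :=
  forall i x, dom i x -> expR (kappa x) * form_norm2 K i x = 4.

Definition nav_metric (K : kropina) (kappa : M -> R) : cotensor2 :=
  fun i x => expR (kappa x) *: ka K i x.

Definition nav_covector (K : kropina) (kappa : M -> R) : covector_field :=
  fun i x => (expR (kappa x) / 2) *: kb K i x.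

Definition nav_field (K : kropina) (kappa : M -> R) : vector_field :=
  fun i x => \row_k \sum_(l < n)
    invmx (nav_metric K kappa i x) k l * nav_covector K kappa i x 0 l.

(* (L_X g)_kl = X^m d_m g_kl + g_ml d_k X^m + g_km d_l X^m in the chart [i]. *)
Definition lie_derivative (X : vector_field) (g : cotensor2) (i : atlas M)
    (x : M) (k l : 'I_n) : R :=
  let d (m : 'I_n) (f : M -> R) : R :=
    'D_(delta_mx 0 m) (fun u : 'rV[R]_n => f (point i u)) (coord i x) in
  \sum_(m < n) (X i x 0 m * d m (fun p => g i p k l)
                + g i x m l * d k (fun p => X i p 0 m)
                + g i x k m * d l (fun p => X i p 0 m)).

Definition killing (g : cotensor2) (X : vector_field) : Prop :=
  forall i x, dom i x -> forall k l, lie_derivative X g i x k l = 0.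

Definition unit_field (g : cotensor2) (X : vector_field) : Prop :=
  forall i x, dom i x -> bilinear (g i x) (X i x) (X i x) = 1.

Definition strong_kropina (K : kropina) (kappa : M -> R) : Prop :=
  unit_field (nav_metric K kappa) (nav_field K kappa) /\
  killing (nav_metric K kappa) (nav_field K kappa).

Definition finsler_local_isometry (K : kropina) (U : set M) (f : M -> M) :
    Prop :=
  forall i j x, U x -> dom i x -> dom j (f x) ->
  forall y, 0 < beta K i x y ->
    0 < beta K j (f x) (tangent_map f i j x y) /\
    kropina_metric K j (f x) (tangent_map f i j x y) = kropina_metric K i x y.

Definition riemannian_local_isometry (g : cotensor2) (U : set M) (f : M -> M) :
    Prop :=
  forall i j x, U x -> dom i x -> dom j (f x) ->
  forall y z,
    bilinear (g j (f x)) (tangent_map f i j x y) (tangent_map f i j x z) =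
    bilinear (g i x) y z.

(* The data (U, eps, (phi_t)_{|t| < eps}). *)
Record flow_piece := FlowPiece {
  fp_dom : set M;
  fp_eps : R;
  fp_map : R -> M -> M
}.

Record local_flow (X : vector_field) (P : flow_piece) : Prop := LocalFlow {
  flow_open : open (fp_dom P);
  flow_eps : 0 < fp_eps P;
  flow_transformation : forall t, `|t| < fp_eps P ->
    local_transformation (fp_dom P) (fp_map P t);
  flow0 : forall q, fp_dom P q -> fp_map P 0 q = q;
  flowD : forall s t q, `|s| < fp_eps P -> `|t| < fp_eps P ->
    `|s + t| < fp_eps P -> fp_dom P q -> fp_dom P (fp_map P t q) ->
    fp_map P (s + t) q = fp_map P s (fp_map P t q);
  flow_continuous : forall t q, `|t| < fp_eps P -> fp_dom P q ->
    {for (t, q), continuous (fun z : R * M => fp_map P z.1 z.2)};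
  flow_smooth : forall i j,
    smooth_on [set z : R * 'rV[R]_n |
        `|z.1| < fp_eps P /\
        exists q, [/\ fp_dom P q, dom i q, dom j (fp_map P z.1 q) &
                      coord i q = z.2]]
      (fun z : R * 'rV[R]_n => in_charts (fp_map P z.1) i j z.2);
  flow_generates : forall i t q, `|t| < fp_eps P -> fp_dom P q ->
    dom i (fp_map P t q) ->
    is_derive t 1 (fun s : R => coord i (fp_map P s q)) (X i (fp_map P t q))
}.

(* Any collection of local flows of [X] with domains covering the manifold. *)
Definition local_one_parameter_group (X : vector_field) (G : set flow_piece) :
    Prop :=
  (forall P, G P -> local_flow X P) /\
  (forall p : M, exists2 P, G P & fp_dom P p).

End Manifold.

(* Main.v *)
Require Import Defs.
From HB Require Import structures.
From mathcomp Require Import all_boot all_order all_algebra.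
From mathcomp Require Import all_classical all_reals all_analysis.
From mathcomp Require Import ring lra.

Set Implicit Arguments.
Unset Strict Implicit.
Unset Printing Implicit Defensive.

Import Order.TTheory GRing.Theory Num.Theory.
Import numFieldNormedType.Exports.

(* Another [bilinear] is exported by the imports above. *)
Import Defs.

Local Open Scope classical_set_scope.
Local Open Scope ring_scope.

(** Multiplying numerator and denominator of F = alpha^2 / beta by the conformal
    factor gives 2 F(y) = h(y, y) / h(W, y), where W is a field of h-length 1.
    Hence a map that preserves h and W preserves F.  Conversely, let L be a
    linear map between tangent spaces with L W = W' that preserves F.  For z
    orthogonal to W and s > 0, the invariance of F at s W + z, cleared of
    denominators, is
    [s^2 h'(W', L z) + s (h'(L z, L z) - h(z, z)) - h(z, z) h'(W', L z) = 0].
    A polynomial in s with all positive numbers as roots vanishes, so L z is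
    orthogonal to W' and has the length of z: L is an isometry
    ([kropina_isometry_linear]).  The hypothesis L W = W' holds for the
    differential of phi_t because phi_t (phi_s q) = phi_(t + s) q
    ([flow_pushes_field]).  So for each t separately phi_t is a Finslerian local
    isometry if and only if it is a Riemannian one
    ([finsler_riemannian_isometry]), which is the second assertion.

    For the first one, W having length 1, only the Killing equation is at stake,
    and the claim is the classical fact that a field is Killing if and only if
    its flow is isometric.  In a chart the derivative in t of
    h(d phi_t y, d phi_t z) is (L_W h)(d phi_t y, d phi_t z)
    ([is_derive_pullback]): this is the product rule, once it is known that
    d phi_t y solves the linearized equation Y' = DW(Y), and that equation comes
    from exchanging the time derivative and a space derivative of the flow
    ([schwarz_mx], [is_derive_variational]).  If L_W h = 0 then
    h(d phi_t y, d phi_t z) has derivative 0 for all t, in whichever chart it is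
    computed, hence equals its value at t = 0 ([killing_isometry]).  If it is
    constant for small t >= 0 then its derivative at t = 0, which is the Lie
    derivative at the base point, vanishes ([isometry_killing]).

    The functions to be differentiated have to be differentiable.  For W this is
    read off from the flow itself, whose velocity at t = 0 is W
    ([field_differentiable]); the conformal factor is then 2 / beta(W), so h is
    differentiable as well ([nav_metric_differentiable]). *)

(** * Linear algebra: Kropina norms and inner products *)

Section BilinearForms.
Variables (R : realType) (n : nat).
Implicit Types (A : 'M[R]_n) (y z : 'rV[R]_n).

Lemma bilinear_mx A y z : bilinear A y z = (y *m A *m z^T) 0 0.
Proof.
rewrite mxE /bilinear exchange_big/=; apply: eq_bigr => l _.
rewrite !mxE mulr_suml; apply: eq_bigr => k _.
by rewrite (mulrC (y 0 k)).
Qed.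

Lemma bilinearDl A y y' z :
  bilinear A (y + y') z = bilinear A y z + bilinear A y' z.
Proof. by rewrite !bilinear_mx !mulmxDl mxE. Qed.

Lemma bilinearDr A y z z' :
  bilinear A y (z + z') = bilinear A y z + bilinear A y z'.
Proof. by rewrite !bilinear_mx linearD/= mulmxDr mxE. Qed.

Lemma bilinearZl A c y z : bilinear A (c *: y) z = c * bilinear A y z.
Proof. by rewrite !bilinear_mx -!scalemxAl mxE. Qed.

Lemma bilinearZr A c y z : bilinear A y (c *: z) = c * bilinear A y z.
Proof. by rewrite !bilinear_mx linearZ/= -scalemxAr mxE. Qed.

Lemma bilinearC A y z : A^T = A -> bilinear A y z = bilinear A z y.
Proof.
move=> As; rewrite !bilinear_mx -[in RHS]As -[LHS]trace_mx11 -[RHS]trace_mx11.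
by rewrite -mxtrace_tr !trmx_mul trmxK mulmxA.
Qed.

Lemma bilinear_scale A c y z : bilinear (c *: A) y z = c * bilinear A y z.
Proof. by rewrite !bilinear_mx -scalemxAr -scalemxAl mxE. Qed.

Lemma pairing_mx (b y : 'rV[R]_n) : pairing b y = (b *m y^T) 0 0.
Proof. by rewrite /pairing mxE; apply: eq_bigr => k _; rewrite !mxE. Qed.

Lemma pairingZl c (b y : 'rV[R]_n) : pairing (c *: b) y = c * pairing b y.
Proof. by rewrite !pairing_mx -scalemxAl mxE. Qed.

Lemma posdef_unitmx A :
  (forall y, y != 0 -> 0 < bilinear A y y) -> A \in unitmx.
Proof.
move=> Apos; rewrite -row_free_unit; apply/inj_row_free => y yA.
apply: contrapT => /eqP/Apos.
by rewrite bilinear_mx yA mul0mx mxE ltxx.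
Qed.

Lemma quadratic_root3_eq0 (a b c : R) :
  (forall s, 0 < s -> s ^+ 2 * a + s * b + c = 0) -> a = 0 /\ b = 0.
Proof.
move=> H; have := H 1 ltr01; have := H 2 ltac:(lra); have := H 3 ltac:(lra).
by move=> h3 h2 h1; split; lra.
Qed.

(** The invariance of A(y, y) / A(w, y) on the half space A(w, y) > 0 already
    determines A: it is tested on the rays s w + z with z orthogonal to w, and
    the resulting polynomial identity in s is compared coefficientwise.  The
    general vector is then split along w, and polarization gives the bilinear
    form. *)
Lemma kropina_isometry_linear A A' (w w' : 'rV[R]_n)
    (L : {linear 'rV[R]_n -> 'rV[R]_n}) :
  A^T = A -> A'^T = A' -> bilinear A w w = 1 -> bilinear A' w' w' = 1 ->
  L w = w' ->
  (forall y, 0 < bilinear A w y -> 0 < bilinear A' w' (L y) /\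
     bilinear A' (L y) (L y) / bilinear A' w' (L y) =
     bilinear A y y / bilinear A w y) <->
  (forall y z, bilinear A' (L y) (L z) = bilinear A y z).
Proof.
move=> As A's ww w'w' Lw; split=> [H|H y wy]; last by rewrite -Lw !H.
have orth z : bilinear A w z = 0 ->
    bilinear A' w' (L z) = 0 /\ bilinear A' (L z) (L z) = bilinear A z z.
  move=> wz; set a := bilinear A' w' (L z).
  set q := bilinear A' (L z) (L z); set p := bilinear A z z.
  suff: forall s, 0 < s -> s ^+ 2 * a + s * (q - p) + - (p * a) = 0.
    by move=> /quadratic_root3_eq0[-> /eqP]; rewrite subr_eq0 => /eqP.
  move=> s s0.
  have wy : bilinear A w (s *: w + z) = s.
    by rewrite bilinearDr bilinearZr ww wz; lra.
  have w'y : bilinear A' w' (L (s *: w + z)) = s + a.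
    by rewrite linearP Lw bilinearDr bilinearZr w'w' mulr1.
  have yy : bilinear A (s *: w + z) (s *: w + z) = s ^+ 2 + p.
    rewrite bilinearDl !bilinearDr !bilinearZl !bilinearZr ww.
    by rewrite (bilinearC z w As) wz -/p; ring.
  have Lyy : bilinear A' (L (s *: w + z)) (L (s *: w + z)) =
      s ^+ 2 + 2 * s * a + q.
    rewrite linearP Lw bilinearDl !bilinearDr !bilinearZl !bilinearZr w'w'.
    by rewrite (bilinearC (L z) w' A's) -/a -/q; ring.
  have := H (s *: w + z); rewrite wy w'y yy Lyy => /(_ s0)[sa0].
  (* [E] is the cross-multiplied identity; its terms in s^3 cancel. *)
  move=> /eqP; rewrite eqr_div ?lt0r_neq0// => /eqP E; lra.
have diag y : bilinear A' (L y) (L y) = bilinear A y y.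
  pose s := bilinear A w y; pose z := y - s *: w.
  have wz : bilinear A w z = 0.
    rewrite /z -scaleNr bilinearDr bilinearZr ww -/s; ring.
  have [w'z zz] := orth z wz.
  have -> : y = s *: w + z by rewrite /z addrC subrK.
  move: z wz w'z zz => z wz w'z zz.
  rewrite linearP Lw !bilinearDl !bilinearDr !bilinearZl !bilinearZr.
  by rewrite (bilinearC z w As) (bilinearC _ w' A's) w'z wz zz ww w'w'.
move=> y z; have := diag (y + z).
rewrite linearD !bilinearDl !bilinearDr !diag (bilinearC _ _ As).
by rewrite (bilinearC (L z) (L y) A's) (bilinearC z y As); lra.
Qed.

End BilinearForms.
(** * Differential calculus in normed modules *)

Section Calculus.
Variable R : realType.

Lemma near_translate (V : normedModType R) (x : V) (P : V -> Prop) :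
  (\forall z \near x, P z) -> \forall k \near (0 : V), P (k + x).
Proof. by rewrite [\forall z \near _, _](near_shift 0) subr0. Qed.

Lemma differentiable_approx (V W : normedModType R) (f : V -> W) x :
  differentiable f x -> forall e, 0 < e ->
  \forall k \near (0 : V), `|f (k + x) - f x - 'd f x k| <= e * `|k|.
Proof.
move=> /diff_locallyP[_ /eqaddoP H] e e0.
near=> k.
have : `|(f \o shift x - (cst (f x) + 'd f x)) k| <= e * `|k|.
  by near: k; exact: H.
by rewrite [in X in X -> _]/= !fctE/= opprD addrA.
Unshelve. all: by end_near. Qed.

Lemma near_eq_is_diff (V W : normedModType R) (f g : V -> W) x :
  {near x, f =1 g} -> differentiable f x -> is_diff x g ('d f x).
Proof.
move=> fg df; have fgx : f x = g x := nbhs_singleton fg.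
have [dc _] := (diff_locallyP x f).1 df.
have E : g \o shift x = cst (g x) + 'd f x +o_ 0 id.
  apply/eqaddoP => e e0; near=> k.
  rewrite !fctE/= opprD addrA -fgx.
  have -> : g (k + x) = f (k + x).
    by apply/esym; near: k; exact: near_translate fg.
  by near: k; exact: differentiable_approx.
have dg := diff_unique dc E.
by split; [apply/diff_locallyP; rewrite dg|].
Unshelve. all: by end_near. Qed.

Lemma derive_comp (U V W : normedModType R) (f : U -> V) (g : V -> W) x v :
  differentiable f x -> differentiable g (f x) ->
  'D_v (g \o f) x = 'd g (f x) ('D_v f x).
Proof.
move=> df dg; rewrite deriveE; last exact: differentiable_comp.
by rewrite diff_comp// deriveE.
Qed.

Lemma is_derive_comp (V W : normedModType R) (c : R -> V) (g : V -> W)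
    (t : R) v :
  is_derive t 1 c v -> differentiable g (c t) ->
  is_derive t 1 (g \o c) ('d g (c t) v).
Proof.
move=> dc dg; have cd : differentiable c t by apply/derivable1_diffP/ex_derive.
have /derivable1_diffP/derivableP := differentiable_comp cd dg.
by rewrite derive_comp// derive_val.
Qed.

Lemma is_derive_line (V : normedModType R) (v y : V) (s : R) :
  is_derive s 1 (fun s : R => s *: v + y) v.
Proof.
suff H : h^-1 *: (((fun s : R => s *: v + y) \o shift s) (h *: (1 : R)) -
    (s *: v + y)) @[h --> (0 : R)^'] --> v by split; [exact: cvgP H|exact: cvg_lim H].
apply: cvg_near_cst; near=> h.
have h0 : h != 0 by near: h; exact: nbhs_dnbhs_neq.
by rewrite /= scalerDl -(addrA _ (s *: v) y) addrK scalerA [_ *: 1]mulr1 mulVf ?scale1r.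
Unshelve. all: by end_near. Qed.

(** The second difference of f along v and w is, by the mean value theorem in the
    direction v, h times an increment of D_v f over h w; the differentiability
    of D_v f at x alone evaluates it as h^2 D_w D_v f x + o(h^2). *)
Lemma second_difference (V : normedModType R) (f : V -> R) x v w e :
  (\forall z \near x, differentiable f z) -> differentiable ('D_v f) x ->
  0 < e ->
  exists2 d, 0 < d & forall h, 0 < h < d ->
    `|f (h *: v + (h *: w + x)) - f (h *: w + x) - (f (h *: v + x) - f x)
      - h ^+ 2 * 'D_w ('D_v f) x| <= e * h ^+ 2.
Proof.
move=> df dg e0; set g := 'D_v f.
(* The points at which g is compared with its linearization at x have total
   distance at most h C to x; the summand 1 makes C positive. *)
set C := `|v| + `|v| + `|w| + 1.
have C0 : 0 < C by rewrite /C ltr_wpDl// ?addr_ge0.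
have [r /= r0 Hr] : exists2 r, 0 < r & forall k : V, `|k| < r ->
    differentiable f (k + x) /\
    `|g (k + x) - g x - 'd g x k| <= e / C * `|k|.
  have : \forall k \near (0 : V), differentiable f (k + x) /\
      `|g (k + x) - g x - 'd g x k| <= e / C * `|k|.
    near=> k; split; last first.
      by near: k; apply: differentiable_approx => //; rewrite divr_gt0.
    by near: k; exact: near_translate df.
  move=> /nbhs_norm0P[r r0 Hr]; exists r => // k kr; exact: Hr.
exists (r / C) => [|h /andP[h0 hr]]; first by rewrite divr_gt0.
have small s : 0 <= s <= h -> `|s *: v + h *: w| < r /\ `|s *: v| < r /\
    `|s *: v + h *: w| + `|s *: v| <= h * C.
  move=> /andP[s0 sh].
  have B1 : `|s *: v| <= h * `|v|.
    by rewrite normrZ ger0_norm// ler_wpM2r.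
  have B2 : `|s *: v + h *: w| <= h * `|v| + h * `|w|.
    by rewrite (le_trans (ler_normD _ _))// lerD// normrZ gtr0_norm.
  have Ch : h * C < r by rewrite -ltr_pdivlMr.
  have EC : h * C = h * `|v| + h * `|v| + h * `|w| + h by rewrite /C; ring.
  have v0 : 0 <= h * `|v| by rewrite mulr_ge0// ltW.
  have w0 : 0 <= h * `|w| by rewrite mulr_ge0// ltW.
  split; [|split]; lra.
(* The first-order increment along w; the mean value theorem is applied to it
   between 0 and h. *)
pose G (s : R) := f (s *: v + (h *: w + x)) - f (s *: v + x).
have dline (y : V) (s : R) : differentiable f (s *: v + y) ->
    is_derive s 1 (fun s : R => f (s *: v + y)) (g (s *: v + y)).
  move=> dfs; have ds : is_derive s 1 (fun s : R => s *: v + y) v.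
    exact: is_derive_line.
  by rewrite /g deriveE//; exact: is_derive_comp ds dfs.
have dG s : 0 <= s <= h ->
    is_derive s 1 G (g (s *: v + (h *: w + x)) - g (s *: v + x)).
  move=> sh; have [S1 [S2 _]] := small s sh.
  apply: is_deriveB; apply: dline; rewrite ?addrA.
    exact: (Hr _ S1).1.
  exact: (Hr _ S2).1.
have [||c chi] := @MVT R G
   (fun s => g (s *: v + (h *: w + x)) - g (s *: v + x)) 0 h h0.
- move=> s; rewrite in_itv/= => /andP[s0 sh]; apply: dG; lra.
- apply: derivable_within_continuous => s; rewrite in_itv/= => sh.
  by have := dG s sh => -[].
have {}ch : 0 <= c <= h by move: chi; rewrite in_itv/= => /andP[? ?]; lra.
rewrite {1 2}/G !scale0r !add0r subr0 => E.
have [S1 [S2 S3]] := small c ch.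
have -> : f (h *: v + (h *: w + x)) - f (h *: w + x) - (f (h *: v + x) - f x) =
  (g (c *: v + (h *: w + x)) - g (c *: v + x)) * h by rewrite -E; ring.
rewrite deriveE// -/g.
have -> : (g (c *: v + (h *: w + x)) - g (c *: v + x)) * h -
    h ^+ 2 * 'd g x w =
  ((g (c *: v + h *: w + x) - g x - 'd g x (c *: v + h *: w)) -
   (g (c *: v + x) - g x - 'd g x (c *: v))) * h.
  have -> : 'd g x (c *: v + h *: w) = 'd g x (c *: v) + h * 'd g x w.
    by rewrite linearD; congr (_ + _); exact: linearZ.
  by rewrite addrA; ring.
rewrite normrM (gtr0_norm h0) expr2 mulrA ler_pM2r//.
apply: le_trans (ler_normB _ _) _.
apply: le_trans (lerD (Hr _ S1).2 (Hr _ S2).2) _.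
rewrite -mulrDr -mulrA ler_pM2l// mulrC ler_pdivrMr//.
Unshelve. all: by end_near. Qed.

(** Young's form of the symmetry of second derivatives: the second difference is
    symmetric in v and w. *)
Lemma schwarz (V : normedModType R) (f : V -> R) x v w :
  (\forall z \near x, differentiable f z) ->
  differentiable ('D_v f) x -> differentiable ('D_w f) x ->
  'D_w ('D_v f) x = 'D_v ('D_w f) x.
Proof.
move=> df dv dw; apply/eqP; rewrite -subr_eq0 -normr_le0.
apply/ler_addgt0Pl => e e0; rewrite addr0.
have e20 : 0 < e / 2 by rewrite divr_gt0.
have [d1 d10 H1] := second_difference w df dv e20.
have [d2 d20 H2] := second_difference v df dw e20.
pose h := Num.min d1 d2 / 2.
have h0 : 0 < h by rewrite divr_gt0// lt_min d10.
have hd : h < Num.min d1 d2 by rewrite /h; move: h0; rewrite /h; lra.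
move: hd; rewrite lt_min => /andP[h1 h2].
have := H1 h; rewrite h0 => /(_ h1); have := H2 h; rewrite h0 => /(_ h2).
rewrite (addrCA (h *: w) (h *: v) x).
set D := f _; set a := 'D_v _ x; set b := 'D_w _ x; set p := f _; set q := f _.
set o := f x.
move=> E1 E2.
have h20 : 0 < h ^+ 2 by rewrite exprn_gt0.
rewrite -(ler_pM2l h20) -{1}(gtr0_norm h20) -normrM.
have -> : h ^+ 2 * (b - a) = (D - p - (q - o) - h ^+ 2 * a) -
   (D - q - (p - o) - h ^+ 2 * b) by ring.
apply: le_trans (ler_normB _ _) _; apply: le_trans (lerD E1 E2) _.
by rewrite -mulrDl -splitr mulrC.
Qed.

Lemma differentiable_entry (V : normedModType R) m n (f : V -> 'M[R]_(m, n)) x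
    i j :
  differentiable f x -> differentiable (fun z => f z i j) x.
Proof.
move=> df; apply: (@differentiable_comp _ _ _ _ f (fun A : 'M[R]_(m, n) => A i j)) => //.
exact: differentiable_coord.
Qed.

Lemma differentiable_mx (V : normedModType R) m n (f : V -> 'M[R]_(m, n)) x :
  (forall i j, differentiable (fun z => f z i j) x) -> differentiable f x.
Proof.
move=> df.
have -> : f = \sum_(i < m) \sum_(j < n) (fun z => f z i j *: delta_mx i j).
  apply/funext => z; rewrite fct_sumE [LHS]matrix_sum_delta.
  by apply: eq_bigr => i _; rewrite fct_sumE.
apply: differentiable_sum => i; apply: differentiable_sum => j.
exact: differentiableZl.
Qed.

Lemma is_derive_entry (V : normedModType R) m n (f : V -> 'M[R]_(m, n)) x v df
    i j :
  is_derive x v f df -> is_derive x v (fun z => f z i j) (df i j).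
Proof.
move=> [fxv <-]; rewrite derive_mx// mxE.
by apply: derivableP; exact: (derivable_mxP _ _ _).1.
Qed.

Lemma is_derive_sumE (V W : normedModType R) n (f : 'I_n -> V -> W) x v
    (df : 'I_n -> W) :
  (forall i, is_derive x v (f i) (df i)) ->
  is_derive x v (fun z => \sum_i f i z) (\sum_i df i).
Proof.
move=> dfi; rewrite (_ : (fun z => _) = \sum_i f i); last by rewrite fct_sumE.
exact: is_derive_sum.
Qed.

Lemma schwarz_mx (V : normedModType R) m n (f : V -> 'M[R]_(m, n)) x v w :
  (\forall z \near x, differentiable f z) ->
  differentiable ('D_v f) x -> differentiable ('D_w f) x ->
  'D_w ('D_v f) x = 'D_v ('D_w f) x.
Proof.
move=> df dv dw; apply/matrixP => i j.
have entry u : {near x, (fun z => 'D_u f z i j) =1 'D_u (fun z => f z i j)}.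
  near=> z; rewrite /= derive_mx ?mxE//; apply: diff_derivable.
  by near: z.
rewrite derive_mx ?mxE; last exact: diff_derivable.
rewrite derive_mx ?mxE; last exact: diff_derivable.
rewrite (near_eq_derive _ (entry v)) (near_eq_derive _ (entry w)).
apply: schwarz.
- by near=> z; apply: differentiable_entry; near: z.
- by have [] := near_eq_is_diff (entry v) (differentiable_entry i j dv).
- by have [] := near_eq_is_diff (entry w) (differentiable_entry i j dw).
Unshelve. all: by end_near. Qed.

Lemma diff_delta (W : normedModType R) n (f : 'rV[R]_n -> W) u y :
  differentiable f u ->
  'd f u y = \sum_(m < n) y 0 m *: 'D_(delta_mx 0 m) f u.
Proof.
move=> df; rewrite {1}[y]row_sum_delta linear_sum/=.
by apply: eq_bigr => m _; rewrite linearZ deriveE.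
Qed.

Lemma is_derive_pairl (V : normedModType R) (u : V) (t : R) :
  is_derive t 1 (fun s : R => (s, u)) ((1, 0) : R * V).
Proof.
have := is_derive_line ((1, 0) : R * V) (0, u) t.
congr is_derive; apply/funext => s.
by rewrite -[LHS]/(s * 1 + 0, s *: 0 + u) mulr1 addr0 scaler0 add0r.
Qed.

(** The linearized flow equation.  Along s the derivative of D_(0, y) Phi is
    D_(1, 0) D_(0, y) Phi; exchanging the two derivatives turns it into the
    derivative of X o Phi in the direction (0, y). *)
Lemma is_derive_variational n (Phi : R * 'rV[R]_n -> 'rV[R]_n)
    (X : 'rV[R]_n -> 'rV[R]_n) t u y :
  (\forall z \near (t, u), differentiable Phi z) ->
  differentiable ('D_(1, 0) Phi) (t, u) ->
  differentiable ('D_(0, y) Phi) (t, u) ->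
  (\forall z \near (t, u), 'D_(1, 0) Phi z = X (Phi z)) ->
  differentiable X (Phi (t, u)) ->
  is_derive t 1 (fun s : R => 'D_(0, y) Phi (s, u))
    ('d X (Phi (t, u)) ('D_(0, y) Phi (t, u))).
Proof.
move=> dPhi d1 d2 flow dX.
have := is_derive_comp (is_derive_pairl u t) d2.
rewrite -deriveE// (schwarz_mx dPhi d2 d1) (near_eq_derive _ flow).
by rewrite (derive_comp (f := Phi) (g := X))//; exact: nbhs_singleton dPhi.
Qed.

(** The formula of [lie_derivative], for a vector field and a tensor field on an
    open set of R^n. *)
Definition lie_coef n (X : 'rV[R]_n -> 'rV[R]_n) (H : 'rV[R]_n -> 'M[R]_n)
    (u : 'rV[R]_n) (k l : 'I_n) : R :=
  \sum_(m < n) (X u 0 m * 'D_(delta_mx 0 m) (fun w => H w k l) u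
                + H u m l * 'D_(delta_mx 0 k) (fun w => X w 0 m) u
                + H u k m * 'D_(delta_mx 0 l) (fun w => X w 0 m) u).

(** If c is an integral curve of X, and Y, Z are transported by the linearized
    flow, then the rate of change of H(Y, Z) along c is (L_X H)(Y, Z).  It is the
    product rule, followed by an exchange of summation indices that puts the
    derivatives of X in the position they have in the Lie derivative. *)
Lemma is_derive_bilinear_flow n (X : 'rV[R]_n -> 'rV[R]_n)
    (H : 'rV[R]_n -> 'M[R]_n) (c Y Z : R -> 'rV[R]_n) (t : R) :
  differentiable H (c t) -> differentiable X (c t) ->
  is_derive t 1 c (X (c t)) ->
  is_derive t 1 Y ('d X (c t) (Y t)) -> is_derive t 1 Z ('d X (c t) (Z t)) ->
  is_derive t 1 (fun s => bilinear (H (c s)) (Y s) (Z s))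
    (\sum_(k < n) \sum_(l < n) lie_coef X H (c t) k l * Y t 0 k * Z t 0 l).
Proof.
move=> dH dX dc dY dZ.
have field (y : 'rV[R]_n) k : ('d X (c t) y) 0 k =
    \sum_(m < n) y 0 m * 'D_(delta_mx 0 m) (fun w => X w 0 k) (c t).
  rewrite diff_delta// summxE; apply: eq_bigr => m _.
  by rewrite derive_mx ?mxE//; exact: diff_derivable.
pose DH k l := \sum_(m < n) X (c t) 0 m *
  'D_(delta_mx 0 m) (fun w => H w k l) (c t).
have -> : \sum_(k < n) \sum_(l < n) lie_coef X H (c t) k l * Y t 0 k * Z t 0 l
  = \sum_(k < n) \sum_(l < n)
     ((H (c t) k l * Y t 0 k) *: ('d X (c t) (Z t)) 0 l +
      Z t 0 l *: (H (c t) k l *: ('d X (c t) (Y t)) 0 k +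
        Y t 0 k *: DH k l)).
  pose A k l m := H (c t) k l * Z t 0 l * Y t 0 m *
    'D_(delta_mx 0 m) (fun w => X w 0 k) (c t).
  pose B k l m := H (c t) k l * Y t 0 k * Z t 0 m *
    'D_(delta_mx 0 m) (fun w => X w 0 l) (c t).
  transitivity (\sum_(k < n) \sum_(l < n) DH k l * Y t 0 k * Z t 0 l +
    \sum_(k < n) \sum_(l < n) \sum_(m < n) A k l m +
    \sum_(k < n) \sum_(l < n) \sum_(m < n) B k l m).
    have -> : \sum_(k < n) \sum_(l < n) \sum_(m < n) A k l m =
        \sum_(k < n) \sum_(l < n) \sum_(m < n) A m l k.
      rewrite exchange_big [RHS]exchange_big/=; apply: eq_bigr => l _.
      by rewrite exchange_big.
    have -> : \sum_(k < n) \sum_(l < n) \sum_(m < n) B k l m =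
        \sum_(k < n) \sum_(l < n) \sum_(m < n) B k m l.
      by apply: eq_bigr => k _; rewrite exchange_big.
    rewrite -!big_split/=; apply: eq_bigr => k _.
    rewrite -!big_split/=; apply: eq_bigr => l _.
    rewrite /lie_coef /DH !mulr_suml -!big_split/=; apply: eq_bigr => m _.
    by rewrite /A /B; ring.
  rewrite -!big_split/=; apply: eq_bigr => k _.
  rewrite -!big_split/=; apply: eq_bigr => l _.
  move: (DH k l) => dH_kl; rewrite !field /GRing.scale/= mulrDr.
  rewrite [LHS]addrC; congr (_ + _).
    by rewrite mulr_sumr; apply: eq_bigr => m _; rewrite /B; ring.
  rewrite [LHS]addrC; congr (_ + _); last by ring.
  by rewrite !mulr_sumr; apply: eq_bigr => m _; rewrite /A; ring.
apply: is_derive_sumE => k; apply: is_derive_sumE => l.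
have dHkl : is_derive t 1 (fun s => H (c s) k l) (DH k l).
  have := is_derive_comp dc (differentiable_entry k l dH).
  rewrite diff_delta; last exact: differentiable_entry.
  exact.
have dYk := is_derive_entry 0 k dY; have dZl := is_derive_entry 0 l dZ.
have dHY := is_deriveM dHkl dYk.
exact: (is_deriveM dHY dZl).
Qed.

End Calculus.
(** * Charts *)

Section Product.
Variables (S T : topologicalType) (s : S) (t : T).

Lemma cvg_pairl : (x, t) @[x --> s] --> (s, t).
Proof.
have xs : x @[x --> s] --> s by exact: cvg_id.
have xt : (fun=> t) @ s --> t by exact: cvg_cst.
exact: (cvg_pair xs xt).
Qed.

Lemma cvg_pairr : (s, x) @[x --> t] --> (s, t).
Proof.
have xt : x @[x --> t] --> t by exact: cvg_id.
have xs : (fun=> s) @ t --> s by exact: cvg_cst.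
exact: (cvg_pair xs xt).
Qed.

End Product.
Arguments cvg_pairl {S T} s t.
Arguments cvg_pairr {S T} s t.

Section Charts.
Variables (R : realType) (n : nat) (M : smoothManifold R n).

Lemma near_chart (i : atlas M) (x : M) (P : set M) :
  dom i x -> (\forall z \near x, P z) ->
  \forall u \near coord i x,
    [/\ dom i (point i u), coord i (point i u) = u & P (point i u)].
Proof.
move=> xi Px.
have ci : (coord i @` dom i) (coord i x) by exists x.
have opn : \forall u \near coord i x, (coord i @` dom i) u.
  by apply: open_nbhs_nbhs; split => //; exact: coord_open.
have cnt : \forall u \near coord i x, P (point i u).
  by apply: (point_continuous ci); rewrite coordK.
near=> u; have [q qi qu] : (coord i @` dom i) u by near: u.
have Pu : P (point i u) by near: u.
by rewrite -qu coordK// in Pu *.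
Unshelve. all: by end_near. Qed.

Lemma near_dom (i : atlas M) (x : M) : dom i x -> \forall z \near x, dom i z.
Proof. by move=> xi; apply: open_nbhs_nbhs; split => //; exact: dom_open. Qed.

(** The chain rule for a change of chart in the target; with it, expressions that
    are invariant under transition maps do not depend on the target chart. *)
Lemma tangent_map_change (f : M -> M) (i j j' : atlas M) x y :
  {for x, continuous f} -> dom i x -> dom j (f x) -> dom j' (f x) ->
  differentiable (in_charts f i j) (coord i x) ->
  tangent_map f i j' x y =
  tangent_map id j j' (f x) (tangent_map f i j x y).
Proof.
move=> fx xi fxj fxj' df.
have E : {near coord i x,
    (in_charts id j j' \o in_charts f i j) =1 in_charts f i j'}.
  have := near_chart xi (fx _ (near_dom fxj)); apply: filterS => u [_ _].
  by rewrite /in_charts/= => ?; rewrite coordK.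
have fj : in_charts f i j (coord i x) = coord j (f x).
  by rewrite /in_charts coordK.
have dT : differentiable (in_charts id j j') (in_charts f i j (coord i x)).
  by rewrite fj; apply: (transition_smooth j j' 1%N).1; exists (f x).
have [_ dE] := near_eq_is_diff E (differentiable_comp df dT).
apply: etrans (congr1 (fun h => h y) dE) _.
apply: etrans (congr1 (fun h => h y) (diff_comp df dT)) _.
by rewrite /tangent_map/= -fj.
Qed.

Lemma tangent_map_id (f : M -> M) (i : atlas M) x y :
  dom i x -> (\forall z \near x, f z = z) -> tangent_map f i i x y = y.
Proof.
move=> xi fid.
have E : {near coord i x, id =1 in_charts f i i}.
  have := near_chart xi fid; apply: filterS => u [_ ui].
  by rewrite /in_charts => ->.
have [_ dE] := near_eq_is_diff E (@ex_diff _ _ _ _ _ _ _ (is_diff_id _)).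
by rewrite /tangent_map dE diff_val.
Qed.

Lemma local_transformation_differentiable (U : set M) f i j x :
  local_transformation U f -> U x -> dom i x -> dom j (f x) ->
  {for x, continuous f} /\ differentiable (in_charts f i j) (coord i x).
Proof.
move=> [_ _ [fc fs] _] Ux xi fxj; split; first exact: fc.
by apply: (fs i j 1%N).1; exists x.
Qed.

End Charts.

(** * Local flows in charts *)

Section Flow.
Variables (R : realType) (n : nat) (M : smoothManifold R n).
Variables (X : vector_field M) (P : flow_piece M).
Hypothesis XP : local_flow X P.

Definition flow_in_charts (i j : atlas M) (z : R * 'rV[R]_n) : 'rV[R]_n :=
  in_charts (fp_map P z.1) i j z.2.
Local Notation Phi := flow_in_charts.

(** Since the flow is jointly continuous in time and space, its local expression
    is meaningful near (t, coord i q), and derivatives may be taken there. *)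
Lemma flow_near i j t q :
  `|t| < fp_eps P -> fp_dom P q -> dom i q -> dom j (fp_map P t q) ->
  \forall z \near (t, coord i q), `|z.1| < fp_eps P /\
    [/\ fp_dom P (point i z.2), dom i (point i z.2),
        dom j (fp_map P z.1 (point i z.2)) & coord i (point i z.2) = z.2].
Proof.
move=> te Uq qi qj.
have nt : \forall z \near (t, coord i q), `|z.1| < fp_eps P.
  have /= : \forall s \near t, `|s| < fp_eps P.
    by apply: (cvgr_norm_lt _ (@cvg_id _ (nbhs t))).
  exact: cvg_fst.
have nU : \forall z \near q, fp_dom P z.
  by apply: open_nbhs_nbhs; split => //; exact: flow_open XP.
have nq : \forall z \near (t, coord i q), [/\ dom i (point i z.2),
    coord i (point i z.2) = z.2 & fp_dom P (point i z.2)].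
  have := near_chart qi nU.
  exact: cvg_snd.
have nj : \forall z \near (t, coord i q), dom j (fp_map P z.1 (point i z.2)).
  have pc : (z.1, point i z.2) @[z --> (t, coord i q)] --> (t, q).
    have ci : (coord i @` dom i) (coord i q) by exists q.
    have := point_continuous ci; rewrite /prop_for /continuous_at coordK// => H.
    have fst_t : z.1 @[z --> (t, coord i q)] --> t by exact: cvg_fst.
    have snd_q : z.2 @[z --> (t, coord i q)] --> coord i q by exact: cvg_snd.
    exact: (cvg_pair fst_t (cvg_comp _ _ snd_q H)).
  exact: (pc _ (flow_continuous XP te Uq (near_dom qj))).
near=> z; have [] : [/\ dom i (point i z.2),
    coord i (point i z.2) = z.2 & fp_dom P (point i z.2)] by near: z.
by split; [near: z|split => //; near: z].
Unshelve. all: by end_near. Qed.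
Section FlowCalculus.
Variables (i j : atlas M) (t : R) (q : M).
Hypotheses (te : `|t| < fp_eps P) (Uq : fp_dom P q).
Hypotheses (qi : dom i q) (qj : dom j (fp_map P t q)).

Lemma flow_domain_nbhs : \forall z \near (t, coord i q),
  `|z.1| < fp_eps P /\ exists q', [/\ fp_dom P q', dom i q',
    dom j (fp_map P z.1 q') & coord i q' = z.2].
Proof.
apply: filterS (flow_near te Uq qi qj) => z [ze [Uz zi zj zz]].
by split => //; exists (point i z.2).
Qed.

Lemma flow_differentiable :
  \forall z \near (t, coord i q), differentiable (Phi i j) z.
Proof.
by apply: filterS flow_domain_nbhs => z; exact: (flow_smooth XP i j 1%N).1.
Qed.

Lemma flow_derive_differentiable v :
  differentiable ('D_v (Phi i j)) (t, coord i q).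
Proof.
by apply: ((flow_smooth XP i j 2%N).2 v).1; exact: (nbhs_singleton flow_domain_nbhs).
Qed.

(** The flow equation holds on a neighbourhood in space and time, so it may be
    differentiated in the space directions. *)
Lemma flow_velocity : \forall z \near (t, coord i q),
  'D_(1, 0) (Phi i j) z = X j (point j (Phi i j z)).
Proof.
apply: filterS (filterI flow_differentiable (flow_near te Uq qi qj))
  => -[s u] [dz [/= se [Uz zi zj zu]]].
rewrite {2}/flow_in_charts /in_charts/= coordK//.
have := is_derive_comp (is_derive_pairl u s) dz.
rewrite -deriveE// => /(@derive_val _ _ _ _ _ _ _) <-.
exact: (@derive_val _ _ _ _ _ _ _ (flow_generates XP se Uz zj)).
Qed.

Lemma flow_tangent_map y :
  'D_(0, y) (Phi i j) (t, coord i q) = tangent_map (fp_map P t) i j q y.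
Proof.
have [_ df] := local_transformation_differentiable
  (flow_transformation XP te) Uq qi qj.
apply: etrans (deriveE y df); rewrite /derive.
suff -> : (fun h : R => h^-1 *: ((Phi i j \o shift (t, coord i q)) (h *: (0, y))
      - Phi i j (t, coord i q))) =
    (fun h : R => h^-1 *: ((in_charts (fp_map P t) i j \o shift (coord i q)) (h *: y)
      - in_charts (fp_map P t) i j (coord i q))) by [].
apply/funext => h; congr (_ *: (_ - _)).
by rewrite /flow_in_charts/= scaler0 add0r.
Qed.

End FlowCalculus.

Lemma flow_chart_near j t q : `|t| < fp_eps P -> fp_dom P q ->
  dom j (fp_map P t q) ->
  \forall s \near t, `|s| < fp_eps P /\ dom j (fp_map P s q).
Proof.
move=> te Uq qj; have [i qi] := dom_cover q.
have pc := cvg_pairl t q.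
have sj : \forall s \near t, dom j (fp_map P s q).
  exact: (pc _ (flow_continuous XP te Uq (near_dom qj))).
have se : \forall s \near t, `|s| < fp_eps P.
  by apply: (cvgr_norm_lt _ (@cvg_id _ (nbhs t))).
exact: filterI se sj.
Qed.

(** Both sides are the velocity at s = 0 of the curve
    phi_t (phi_s q) = phi_(t + s) q. *)
Lemma flow_pushes_field i j t q :
  `|t| < fp_eps P -> fp_dom P q -> dom i q -> dom j (fp_map P t q) ->
  tangent_map (fp_map P t) i j q (X i q) = X j (fp_map P t q).
Proof.
move=> te Uq qi qj.
have e0 : `|0 : R| < fp_eps P by rewrite normr0; exact: flow_eps XP.
have q0 : fp_map P 0 q = q := flow0 XP Uq.
have [_ df] := local_transformation_differentiable
  (flow_transformation XP te) Uq qi qj.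
(* A line in the form of [is_derive_line]. *)
pose c (s : R) : R := s *: 1 + t.
have cE s : c s = t + s by rewrite /c addrC [s *: 1]mulr1.
pose g (s : R) := coord j (fp_map P s q).
have dg : is_derive (c 0) 1 g (X j (fp_map P t q)).
  by rewrite cE addr0; exact: flow_generates.
have ds : is_derive (0 : R) 1 (g \o c) (X j (fp_map P t q)).
  have dgc : differentiable g (c 0) by apply/derivable1_diffP/ex_derive.
  have := is_derive_comp (is_derive_line (1 : R) t 0) dgc.
  by rewrite -deriveE// derive_val.
have d0 : is_derive (0 : R) 1 (fun s => coord i (fp_map P s q)) (X i q).
  by have := flow_generates XP e0 Uq; rewrite q0; apply.
have df0 : differentiable (in_charts (fp_map P t) i j)
    (coord i (fp_map P 0 q)) by rewrite q0.
have := is_derive_comp d0 df0; rewrite q0 => dc.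
have E : {near (0 : R), (in_charts (fp_map P t) i j \o
    (fun s => coord i (fp_map P s q))) =1
    g \o c}.
  have U0 : \forall s \near (0 : R), fp_dom P (fp_map P s q).
    have pc := cvg_pairl (0 : R) q.
    apply: (pc _ (flow_continuous XP e0 Uq _)) => /=; rewrite q0.
    by apply: open_nbhs_nbhs; split => //; exact: flow_open XP.
  have ts : \forall s \near (0 : R), `|t + s| < fp_eps P.
    have cts : t + s @[s --> (0 : R)] --> t.
      rewrite -[X in _ --> X]addr0.
      by apply: cvgD; [exact: cvg_cst|exact: cvg_id].
    exact: (cvgr_norm_lt _ cts).
  have i0 : \forall s \near (0 : R), `|s| < fp_eps P /\ dom i (fp_map P s q).
    by apply: flow_chart_near => //; rewrite q0.
  near=> s; rewrite /= /in_charts.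
  have [se si] : `|s| < fp_eps P /\ dom i (fp_map P s q) by near: s.
  rewrite coordK// /g cE (flowD XP)//; by near: s.
have := near_eq_is_derive E dc => -[_].
by rewrite (@derive_val _ _ _ _ _ _ _ ds).
Unshelve. all: by end_near. Qed.

End Flow.

Section FlowField.
Variables (R : realType) (n : nat) (M : smoothManifold R n).
Variables (X : vector_field M) (G : set (flow_piece M)).
Hypothesis XG : local_one_parameter_group X G.

(** A field with a smooth flow is differentiable, as it is the partial
    derivative of the flow in time, at time 0.  For the navigation field this
    avoids differentiating the inverse matrix in its definition. *)
Lemma field_differentiable (j : atlas M) (p : M) : dom j p ->
  differentiable (fun u => X j (point j u)) (coord j p).
Proof.
move=> pj; have [P GP Up] := XG.2 p; have XP := XG.1 P GP.
have e0 : `|0 : R| < fp_eps P by rewrite normr0; exact: flow_eps XP.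
have p0 : dom j (fp_map P 0 p) by rewrite (flow0 XP Up).
pose Y u := 'D_(1, 0) (flow_in_charts P j j) ((0 : R), u).
have dY : differentiable Y (coord j p).
  apply: (@differentiable_comp _ _ _ _ (fun u => ((0 : R), u))
    ('D_(1, 0) (flow_in_charts P j j))).
    by apply: differentiable_pair.
  exact: (flow_derive_differentiable XP e0 Up pj p0).
have E : {near coord j p, Y =1 (fun u => X j (point j u))}.
  have near0 (Q : R * 'rV[R]_n -> Prop) : (\forall z \near ((0 : R), coord j p), Q z) ->
      \forall u \near coord j p, Q (0, u).
    have c0 := cvg_pairr (0 : R) (coord j p).
    by move=> /c0.
  apply: filterS (filterI (near0 _ (flow_velocity XP e0 Up pj p0))
    (near0 _ (flow_near XP e0 Up pj p0))) => u [+ [_ [/= Uu uj _ cu]]].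
  rewrite /Y => ->.
  by rewrite /flow_in_charts /in_charts/= (flow0 XP Uu) cu.
by have [] := near_eq_is_diff E dY.
Qed.

End FlowField.
(** * Isometric flows and Killing fields *)

Section Pullback.
Variables (R : realType) (n : nat) (M : smoothManifold R n).
Variables (X : vector_field M) (g : cotensor2 M) (P : flow_piece M).
Hypothesis XP : local_flow X P.

(** In one chart around phi_t q the two transported vectors are partial
    derivatives of the flow, so they satisfy the linearized flow equation. *)
Lemma is_derive_pullback i j t q y z :
  `|t| < fp_eps P -> fp_dom P q -> dom i q -> dom j (fp_map P t q) ->
  differentiable (fun u => X j (point j u)) (coord j (fp_map P t q)) ->
  differentiable (fun u => g j (point j u)) (coord j (fp_map P t q)) ->
  is_derive t 1 (fun s : R => bilinear (g j (fp_map P s q))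
      (tangent_map (fp_map P s) i j q y) (tangent_map (fp_map P s) i j q z))
    (\sum_(k < n) \sum_(l < n) lie_derivative X g j (fp_map P t q) k l *
      tangent_map (fp_map P t) i j q y 0 k *
      tangent_map (fp_map P t) i j q z 0 l).
Proof.
move=> te Uq qi qj dX dg.
pose c (s : R) := coord j (fp_map P s q).
pose H u := g j (point j u); pose V u := X j (point j u).
pose Y v (s : R) := 'D_(0, v) (flow_in_charts P i j) (s, coord i q).
have YE v s : `|s| < fp_eps P -> dom j (fp_map P s q) ->
    Y v s = tangent_map (fp_map P s) i j q v.
  by move=> se sj; exact: (flow_tangent_map XP se Uq qi sj).
have PhiE : flow_in_charts P i j (t, coord i q) = c t.
  by rewrite /flow_in_charts/in_charts/= coordK.
have dY v : is_derive t 1 (Y v) ('d V (c t) (Y v t)).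
  rewrite -PhiE; apply: is_derive_variational.
  - exact: (flow_differentiable XP te Uq qi qj).
  - exact: (flow_derive_differentiable XP te Uq qi qj).
  - exact: (flow_derive_differentiable XP te Uq qi qj).
  - exact: (flow_velocity XP te Uq qi qj).
  - by rewrite PhiE.
have dc : is_derive t 1 c (V (c t)).
  by rewrite /V coordK//; exact: flow_generates.
have := is_derive_bilinear_flow (H := H) dg dX dc (dY y) (dY z).
rewrite !YE// => D.
have -> : (\sum_(k < n) \sum_(l < n) lie_derivative X g j (fp_map P t q) k l *
      tangent_map (fp_map P t) i j q y 0 k *
      tangent_map (fp_map P t) i j q z 0 l) =
    (\sum_(k < n) \sum_(l < n) lie_coef V H (c t) k l *
      tangent_map (fp_map P t) i j q y 0 k *
      tangent_map (fp_map P t) i j q z 0 l).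
  apply: eq_bigr => k _; apply: eq_bigr => l _; congr (_ * _ * _).
  by rewrite /lie_derivative /lie_coef /V /H coordK.
apply: near_eq_is_derive D.
apply: filterS (flow_chart_near XP te Uq qj) => s [se sj].
by rewrite !YE// /H coordK.
Qed.

Lemma flow0_tangent_map i q y : fp_dom P q -> dom i q ->
  tangent_map (fp_map P 0) i i q y = y.
Proof.
move=> Uq qi; apply: tangent_map_id => //.
have : \forall z \near q, fp_dom P z.
  by apply: open_nbhs_nbhs; split => //; exact: flow_open XP.
by apply: filterS => z; exact: (flow0 XP).
Qed.

End Pullback.

Section OneVariable.
Variable R : realType.

Lemma derive0_ball (f : R -> R) (e t : R) :
  (forall s : R, `|s| < e -> is_derive s 1 f 0) -> `|t| < e -> f t = f 0.
Proof.
move=> df te.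
have seg (a b : R) : `|a| < e -> `|b| < e -> a <= b -> f a = f b.
  move=> ae be ab.
  have sub (s : R) : s \in `[a, b] -> `|s| < e.
    rewrite in_itv/= => /andP[sa sb].
    move: ae be; rewrite !ltr_norml => /andP[? ?] /andP[? ?].
    by apply/andP; split; lra.
  have [||c _] := @MVT_segment R f (fun=> 0) a b ab.
  - move=> s sab; apply: df; apply: sub.
    by move: sab; rewrite !in_itv/= => /andP[/ltW-> /ltW->].
  - apply: derivable_within_continuous => s /sub/df[]; exact.
  - by rewrite mul0r => /eqP; rewrite subr_eq0 => /eqP/esym.
have e0 : `|0 : R| < e by rewrite normr0 (le_lt_trans _ te).
have [t0|t0] := leP 0 t; first by rewrite (seg 0 t).
by rewrite (seg t 0)// ltW.
Qed.

(** One-sided constancy suffices because the derivative is known to exist: it is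
    then the limit of the difference quotients from the right. *)
Lemma derive_right_cst (f : R -> R) (a d : R) :
  is_derive a 1 f d -> (\forall h \near 0^'+, f (h + a) = f a) -> d = 0.
Proof.
move=> [df <-] fc; rewrite /derive cvg_at_rightE//.
apply: cvg_lim => //; apply: cvg_near_cst; near=> h.
have -> : (f \o shift a) (h *: 1) = f a.
  by rewrite /= [h *: 1]mulr1; near: h.
by rewrite subrr scaler0.
Unshelve. all: by end_near. Qed.

End OneVariable.

Section Isometries.
Variables (R : realType) (n : nat) (M : smoothManifold R n).
Variables (g : cotensor2 M) (X : vector_field M) (P : flow_piece M).
Hypothesis XP : local_flow X P.
Hypothesis g_change : forall i j x, dom i x -> dom j x -> forall y z,
  bilinear (g j x) (tangent_map id i j x y) (tangent_map id i j x z) =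
  bilinear (g i x) y z.
Hypothesis dX : forall i x, dom i x ->
  differentiable (fun u => X i (point i u)) (coord i x).
Hypothesis dg : forall i x, dom i x ->
  differentiable (fun u => g i (point i u)) (coord i x).

(** As phi_t q moves it leaves any fixed chart.  The length function f is
    therefore computed at each time in some chart around phi_t q; near each time
    it agrees with its expression in one fixed chart, where the derivative is
    given by the Lie derivative. *)
Lemma killing_isometry t : killing g X -> `|t| < fp_eps P ->
  riemannian_local_isometry g (fp_dom P) (fp_map P t).
Proof.
move=> gX te i j q Uq qi qj y z.
pose chart (x : M) := sval (cid (dom_cover x)).
have chartP x : dom (chart x) x by rewrite /chart; case: cid.
pose len k s := bilinear (g k (fp_map P s q))
  (tangent_map (fp_map P s) i k q y) (tangent_map (fp_map P s) i k q z).
have len_chart s k k' : `|s| < fp_eps P -> dom k (fp_map P s q) ->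
    dom k' (fp_map P s q) -> len k' s = len k s.
  move=> se sk sk'.
  have [cf df] := local_transformation_differentiable
    (flow_transformation XP se) Uq qi sk.
  rewrite /len (tangent_map_change y cf qi sk sk' df).
  by rewrite (tangent_map_change z cf qi sk sk' df) g_change.
pose f s := len (chart (fp_map P s q)) s.
have df (s : R) : `|s| < fp_eps P -> is_derive s 1 f 0.
  move=> se; set k := chart (fp_map P s q).
  have sk : dom k (fp_map P s q) by exact: chartP.
  have := is_derive_pullback XP y z se Uq qi sk (dX sk) (dg sk).
  rewrite big1 => [|a _]; last first.
    by rewrite big1// => b _; rewrite gX// !mul0r.
  apply: near_eq_is_derive.
  apply: filterS (flow_chart_near XP se Uq sk) => r [re rk].
  exact: len_chart.
have e0 : `|0 : R| < fp_eps P by rewrite normr0; exact: flow_eps XP.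
have q0 : dom i (fp_map P 0 q) by rewrite (flow0 XP Uq).
have ft : f t = len j t by exact: len_chart.
have f0 : f 0 = len i 0 by exact: len_chart.
apply: etrans (esym ft) _; apply: etrans (derive0_ball df te) _.
apply: etrans f0 _.
by rewrite /len (flow0_tangent_map XP y Uq qi) (flow0_tangent_map XP z Uq qi)
  (flow0 XP Uq).
Qed.

(** The components of the Lie derivative are its values on the coordinate
    vectors, and at time 0 the differential of the flow is the identity. *)
Lemma isometry_killing i q : fp_dom P q -> dom i q ->
  (forall t, 0 < t -> t < fp_eps P ->
     riemannian_local_isometry g (fp_dom P) (fp_map P t)) ->
  forall k l, lie_derivative X g i q k l = 0.
Proof.
move=> Uq qi iso k l.
have e0 : `|0 : R| < fp_eps P by rewrite normr0; exact: flow_eps XP.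
have q0 : dom i (fp_map P 0 q) by rewrite (flow0 XP Uq).
have := is_derive_pullback XP (delta_mx 0 k) (delta_mx 0 l) e0 Uq qi q0
  (dX q0) (dg q0).
rewrite (flow0 XP Uq) (flow0_tangent_map XP _ Uq qi)
  (flow0_tangent_map XP _ Uq qi) => /derive_right_cst H.
have {H} : \sum_(a < n) \sum_(b < n) lie_derivative X g i q a b *
    (delta_mx 0 k : 'rV[R]_n) 0 a * (delta_mx 0 l : 'rV[R]_n) 0 b = 0.
  apply: H; have near0 := flow_chart_near XP e0 Uq q0.
  have nr : \forall s \near 0^'+, `|s| < fp_eps P /\ dom i (fp_map P s q).
    exact: (cvg_at_right_filter cvg_id).
  have gt0 : \forall s \near (0 : R)^'+, 0 < s by exact: nbhs_right_gt.
  apply: filterS (filterI gt0 nr) => s [s0 [se si]].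
  rewrite addr0.
  rewrite (flow0_tangent_map XP _ Uq qi) (flow0_tangent_map XP _ Uq qi).
  rewrite (flow0 XP Uq) iso//.
  by rewrite (le_lt_trans _ se)// ler_norm.
rewrite (bigD1 k)//= [X in _ + X]big1 ?addr0 => [|a ak]; last first.
  rewrite big1// => b _.
  by rewrite [delta_mx 0 k 0 a]mxE (negbTE ak) andbF mulr0 mul0r.
rewrite (bigD1 l)//= [X in _ + X]big1 ?addr0 => [|b bl]; last first.
  by rewrite [delta_mx 0 l 0 b]mxE (negbTE bl) andbF mulr0.
by rewrite !mxE !eqxx !mulr1.
Qed.

End Isometries.

(** * The navigation data of a Kropina space *)

Section Navigation.
Variables (R : realType) (n : nat) (M : smoothManifold R n).
Variables (K : kropina M) (kappa : M -> R).
Hypothesis kappaP : is_kappa K kappa.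

Local Notation h := (nav_metric K kappa).
Local Notation w := (nav_covector K kappa).
Local Notation W := (nav_field K kappa).

Lemma nav_metric_sym i x : dom i x -> (h i x)^T = h i x.
Proof. by move=> xi; rewrite /nav_metric linearZ/= (metric_sym (ka_metric K)). Qed.

Lemma nav_metric_pos i x y : dom i x -> y != 0 -> 0 < bilinear (h i x) y y.
Proof.
move=> xi y0; rewrite /nav_metric bilinear_scale mulr_gt0 ?expR_gt0//.
exact: (metric_pos (ka_metric K)).
Qed.

Lemma nav_metric_change i j x : dom i x -> dom j x -> forall y z,
  bilinear (h j x) (tangent_map id i j x y) (tangent_map id i j x z) =
  bilinear (h i x) y z.
Proof.
move=> xi xj y z; rewrite /nav_metric !bilinear_scale.
by rewrite (metric_change (ka_metric K)).
Qed.

Lemma nav_field_mx i x : dom i x -> W i x = w i x *m invmx (h i x).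
Proof.
move=> xi; apply/rowP => k; rewrite !mxE; apply: eq_bigr => l _.
rewrite mulrC; congr (_ * _).
by rewrite -[in RHS](nav_metric_sym xi) -trmx_inv mxE.
Qed.

Lemma nav_field_dual i x y : dom i x ->
  bilinear (h i x) (W i x) y = pairing (w i x) y.
Proof.
move=> xi; rewrite bilinear_mx pairing_mx nav_field_mx// -[X in X *m _]mulmxA.
rewrite mulVmx ?mulmx1//; apply: posdef_unitmx => z.
exact: nav_metric_pos.
Qed.

Lemma nav_field_beta i x y : dom i x ->
  bilinear (h i x) (W i x) y = expR (kappa x) / 2 * beta K i x y.
Proof. by move=> xi; rewrite nav_field_dual// /nav_covector pairingZl. Qed.

Lemma nav_field_unit : unit_field h W.
Proof.
move=> i x xi; rewrite nav_field_dual// pairing_mx nav_field_mx//.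
rewrite trmx_mul trmx_inv nav_metric_sym// mulmxA -bilinear_mx.
rewrite /nav_metric /nav_covector bilinearZl bilinearZr.
have ex0 : expR (kappa x) != 0 by rewrite gt_eqF ?expR_gt0.
rewrite invmxZ; last first.
  by apply: posdef_unitmx => z; exact: nav_metric_pos.
rewrite bilinear_scale -/(form_norm2 K i x).
have := kappaP xi => E; have -> : form_norm2 K i x = 4 / expR (kappa x).
  by rewrite -E mulrC mulKf.
by field.
Qed.

Lemma kropina_metricE i x y : dom i x ->
  kropina_metric K i x y =
  2^-1 * (bilinear (h i x) y y / bilinear (h i x) (W i x) y).
Proof.
move=> xi; rewrite /kropina_metric /alpha sqr_sqrtr; last first.
  have [->|y0] := eqVneq y 0; first by rewrite bilinear_mx !mul0mx mxE.
  exact/ltW/(metric_pos (ka_metric K)).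
rewrite nav_field_beta// /nav_metric bilinear_scale.
have ex0 : expR (kappa x) != 0 by rewrite gt_eqF ?expR_gt0.
have [->|b0] := eqVneq (beta K i x y) 0; first by rewrite mulr0 invr0 !mulr0.
by field; rewrite b0 ex0.
Qed.

(** The conformal factor is defined through the inverse matrix of a.  Since W has
    length 1 it is also 2 / beta(W), a quotient of functions that are already
    known to be differentiable. *)
Lemma nav_metric_differentiable i x : dom i x ->
  differentiable (fun u => W i (point i u)) (coord i x) ->
  differentiable (fun u => h i (point i u)) (coord i x).
Proof.
move=> xi dW.
have ci : (coord i @` dom i) (coord i x) by exists x.
have da := (metric_smooth (ka_metric K) i 1%N).1 _ ci.
have db := (form_smooth (kb_form K) i 1%N).1 _ ci.
pose p (u : 'rV[R]_n) := \sum_(k < n) kb K i (point i u) 0 k * W i (point i u) 0 k.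
have pE z : dom i z -> expR (kappa z) = 2 * (pairing (kb K i z) (W i z))^-1.
  move=> zi; have := nav_field_unit zi; rewrite nav_field_beta// /beta => E.
  have p0 : pairing (kb K i z) (W i z) != 0.
    by apply/eqP => p0; move: E; rewrite p0 mulr0 => /esym/eqP; rewrite oner_eq0.
  by apply: (mulIf p0); rewrite mulfVK//; lra.
have dp : differentiable p (coord i x).
  have -> : p = \sum_(k < n) ((fun u => kb K i (point i u) 0 k) *
      (fun u => W i (point i u) 0 k)).
    by apply/funext => u; rewrite fct_sumE.
  apply: differentiable_sum => k.
  by apply: differentiableM; exact: differentiable_entry.
have p0 : p (coord i x) != 0.
  apply/eqP; rewrite /p coordK// -/(pairing (kb K i x) (W i x)) => p0.
  by have := pE x xi; rewrite p0 invr0 mulr0 => /eqP; rewrite gt_eqF ?expR_gt0.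
have E : {near coord i x, (fun u => (2 * (p u)^-1) *: ka K i (point i u)) =1
    (fun u => h i (point i u))}.
  apply: filterS (near_chart xi (near_dom xi)) => u [ui _ _].
  by rewrite /nav_metric pE.
have [] // := near_eq_is_diff E _.
apply: differentiable_mx => k l.
rewrite (_ : (fun u => _) = (cst 2 * (fun u => (p u)^-1)) *
    (fun u => ka K i (point i u) k l)); last first.
  by apply/funext => u; rewrite mxE.
apply: differentiableM; last exact: differentiable_entry.
apply: differentiableM; first exact: differentiable_cst.
exact: differentiableV.
Qed.

End Navigation.
(** The pointwise equivalence of [kropina_isometry_linear], applied to the
    differential of phi_t at each point: it maps W to W because phi_t belongs to
    the flow of W. *)
Lemma finsler_riemannian_isometry (R : realType) (n : nat)
    (M : smoothManifold R n) (K : kropina M) (kappa : M -> R) P t :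
  is_kappa K kappa -> local_flow (nav_field K kappa) P -> `|t| < fp_eps P ->
  finsler_local_isometry K (fp_dom P) (fp_map P t) <->
  riemannian_local_isometry (nav_metric K kappa) (fp_dom P) (fp_map P t).
Proof.
move=> kP WP te.
pose h := nav_metric K kappa.
have scale_gt0 x (a : R) : (0 < expR (kappa x) / 2 * a) = (0 < a).
  by rewrite pmulr_rgt0// divr_gt0// expR_gt0.
have pointwise i j q : fp_dom P q -> dom i q -> dom j (fp_map P t q) ->
    (forall y, 0 < beta K i q y ->
      0 < beta K j (fp_map P t q) (tangent_map (fp_map P t) i j q y) /\
      kropina_metric K j (fp_map P t q) (tangent_map (fp_map P t) i j q y) =
      kropina_metric K i q y) <->
    (forall y z, bilinear (h j (fp_map P t q))
      (tangent_map (fp_map P t) i j q y) (tangent_map (fp_map P t) i j q z) =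
      bilinear (h i q) y z).
  move=> Uq qi qj.
  have WW := nav_field_unit kP.
  have := @kropina_isometry_linear R n (h i q) (h j (fp_map P t q))
    (nav_field K kappa i q)
    (nav_field K kappa j (fp_map P t q)) ('d (in_charts (fp_map P t) i j) (coord i q))
    (nav_metric_sym K kappa qi) (nav_metric_sym K kappa qj) (WW _ _ qi)
    (WW _ _ qj) (flow_pushes_field WP te Uq qi qj).
  move=> E; split=> [F|F y].
    apply/E => y; rewrite !nav_field_beta// !scale_gt0 => /F[b0 FE].
    split=> //; move: FE; rewrite !(kropina_metricE K kappa)//.
    rewrite !nav_field_beta//.
    by apply: mulfI; rewrite invr_eq0 pnatr_eq0.
  rewrite -(scale_gt0 q) -nav_field_beta// => /(E.2 F y)[b0 FE].
  split; first by move: b0; rewrite nav_field_beta// scale_gt0.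
  by rewrite !(kropina_metricE K kappa)// FE.
by split=> F i j q Uq qi qj; apply/pointwise => //; exact: F.
Qed.

Theorem theorem5p11 (R : realType) (n : nat) (M : smoothManifold R n)
    (K : kropina M) (kappa : M -> R) (hkappa : is_kappa K kappa)
    (G : set (flow_piece M))
    (hG : local_one_parameter_group (nav_field K kappa) G) :
  ((forall P, G P -> forall t, 0 < t -> t < fp_eps P ->
      finsler_local_isometry K (fp_dom P) (fp_map P t)) <->
   strong_kropina K kappa) /\
  (forall P, G P ->
     ((forall t, `|t| < fp_eps P ->
         finsler_local_isometry K (fp_dom P) (fp_map P t)) <->
      (forall t, `|t| < fp_eps P ->
         riemannian_local_isometry (nav_metric K kappa)
           (fp_dom P) (fp_map P t)))).
Proof.
have WP P : G P -> local_flow (nav_field K kappa) P := hG.1 P.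
have dW i x : dom i x ->
    differentiable (fun u => nav_field K kappa i (point i u)) (coord i x).
  by move=> xi; exact: (field_differentiable hG xi).
have dh i x : dom i x ->
    differentiable (fun u => nav_metric K kappa i (point i u)) (coord i x).
  by move=> xi; exact: nav_metric_differentiable (dW i x xi).
have hchange := @nav_metric_change R n M K kappa.
split=> [|P GP]; last first.
  by split=> iso t te; apply/(finsler_riemannian_isometry hkappa (WP P GP) te);
    exact: iso.
split=> [iso|[_ kil] P GP t t0 te]; last first.
  have te' : `|t| < fp_eps P by rewrite gtr0_norm.
  apply/(finsler_riemannian_isometry hkappa (WP P GP) te').
  exact: (killing_isometry (WP P GP) hchange dW dh kil te').
split; first exact: nav_field_unit.
move=> i x xi; have [P GP Ux] := hG.2 x.
apply: (isometry_killing (WP P GP) dW dh Ux xi) => t t0 te.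
apply/finsler_riemannian_isometry; rewrite ?gtr0_norm//; first exact: WP.
exact: iso.
Qed.
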